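(* Let $K$ be a field, let $\mathcal{Q}$ be a finite quiver whose underlying graph is acyclic, and let $R=K\mathcal{Q}$ be its path algebra. If $M$ is an indecomposable multiplicity free $R$-module (of finite length) with lattice of submodules $\Lambda$, then $\mathrm{Ext}_\Lambda$ is the subgraph of $\mathrm{Ext}_R$ induced by $\mathrm{Supp}\, M$.
   Context: A quiver $\mathcal{Q}=(\mathcal{Q}_0,\mathcal{Q}_1,s,t)$ consists of finite sets of vertices $\mathcal{Q}_0$ and arrows $\mathcal{Q}_1$ and source and target maps $s,t:\mathcal{Q}_1\to\mathcal{Q}_0$. Its underlying graph is the undirected (multi)graph with vertex set $\mathcal{Q}_0$ and edge set $\mathcal{Q}_1$; it is acyclic if it has no cycles (in particular no loops and no multiple edges). $K\mathcal{Q}$-modules are identified with representations of $\mathcal{Q}$: families of vector spaces $M_x$ ($x\in\mathcal{Q}_0$) with linear maps $f_\alpha:M_{s(\alpha)}\to M_{t(\alpha)}$ for each arrow $\alpha$, with $M=\bigoplus_{x\in\mathcal{Q}_0}M_x$. $M$ is multiplicity free if each of its composition factors occurs with multiplicity one; equivalently, every $\dim M_x$ is $0$ or $1$. $\mathrm{Supp}\,M=\{x\in\mathcal{Q}_0 : M_x\neq 0\}$. A vertex $x$ is identified with the corresponding simple module, which has $K$ at $x$ and $0$ at all other vertices, so the composition factors of $M$ are identified with the elements of $\mathrm{Supp}\,M$. $\mathrm{Ext}_R$ is the directed graph on $\mathcal{Q}_0$ with an edge from $x$ to $y$ if and only if $\mathrm{Ext}^1_R(x,y)\neq 0$ (there is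 a nonsplit extension with submodule $y$ and quotient $x$). $\mathrm{Ext}_\Lambda$ is the directed graph whose vertices are the composition factors of $M$, with an edge from $x$ to $y$ if and only if there are submodules $W\subset V\subset U$ of $M$ such that $V$ is the unique submodule strictly between $W$ and $U$, $U/V\cong x$ and $V/W\cong y$. If $H$ is a subset of the vertex set of a digraph $G$, the subgraph of $G$ induced by $H$ has vertex set $H$ and has an arrow from $x$ to $y$ if and only if $G$ has one. *)

(* Defs.v *)
From HB Require Import structures.
From mathcomp Require Import all_boot all_order all_algebra.

Set Implicit Arguments.
Unset Strict Implicit.
Unset Printing Implicit Defensive.

Import GRing.Theory VectorInternalTheory.
Local Open Scope ring_scope.
Local Open Scope quotient_scope.

Record quiver := Quiver {
  vertex : finType;
  arrow : finType;
  src : arrow -> vertex;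
  tgt : arrow -> vertex }.

Section Acyclic.
Variable Q : quiver.

Definition joins (a : arrow Q) (x y : vertex Q) : bool :=
  ((src a == x) && (tgt a == y)) || ((src a == y) && (tgt a == x)).

(* A cycle x_1 -a_1- x_2 -a_2- ... x_n -a_n- x_1 (n >= 1) of the underlying
   multigraph, with distinct vertices and distinct edges, is coded as
   [:: (x_1, a_1); ...; (x_n, a_n)].  Loops are the cycles with n = 1, pairs
   of (anti)parallel arrows those with n = 2. *)
Definition graph_cycle (c : seq (vertex Q * arrow Q)) : bool :=
  [&& c != [::], uniq (map fst c), uniq (map snd c)
    & cycle (fun p q => joins p.2 p.1 q.1) c].

Definition acyclic : Prop := forall c, ~~ graph_cycle c.

End Acyclic.

Section QuotientSpace.
Variables (K : fieldType) (vT : vectType K) (W : {vspace vT}).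

Definition quotv : Type := Quotient.quot W.
HB.instance Definition _ := GRing.Zmodule.copy quotv (Quotient.quot W).

Definition quotv_pi_fun (v : vT) : quotv := \pi_(Quotient.quot W) v.

Lemma quotv_pi_funK (q : quotv) :
  quotv_pi_fun (repr (q : Quotient.quot W)) = q.
Proof. exact: reprK. Qed.

Lemma quotv_pi_eq (u v : vT) :
  quotv_pi_fun u = quotv_pi_fun v <-> u - v \in W.
Proof.
by rewrite Quotient.idealrBE; split=> [e | /eqP //]; apply/eqP.
Qed.

Lemma quotv_piD (u v : vT) :
  quotv_pi_fun (u + v) = quotv_pi_fun u + quotv_pi_fun v.
Proof. exact: (raddfD \pi_(Quotient.quot W)). Qed.

Definition quotv_scale (k : K) (q : quotv) : quotv :=
  quotv_pi_fun (k *: repr (q : Quotient.quot W)).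

Lemma quotv_piZ (k : K) (v : vT) :
  quotv_pi_fun (k *: v) = quotv_scale k (quotv_pi_fun v).
Proof.
apply/quotv_pi_eq; rewrite -scalerBr memvZ //.
by apply/quotv_pi_eq; rewrite quotv_pi_funK.
Qed.

Lemma quotv_scaleA (a b : K) (q : quotv) :
  quotv_scale a (quotv_scale b q) = quotv_scale (a * b) q.
Proof.
by rewrite -(quotv_pi_funK q) -!quotv_piZ scalerA.
Qed.

Lemma quotv_scale1 : left_id 1 quotv_scale.
Proof. by move=> q; rewrite -(quotv_pi_funK q) -quotv_piZ scale1r. Qed.

Lemma quotv_scaleDr : right_distributive quotv_scale +%R.
Proof.
move=> k p q; rewrite -(quotv_pi_funK p) -(quotv_pi_funK q) -quotv_piD.
by rewrite -!quotv_piZ scalerDr quotv_piD.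
Qed.

Lemma quotv_scaleDl (q : quotv) : {morph quotv_scale^~ q : a b / a + b}.
Proof.
by move=> a b; rewrite /= -(quotv_pi_funK q) -!quotv_piZ scalerDl quotv_piD.
Qed.

HB.instance Definition _ := GRing.Zmodule_isLmodule.Build K quotv
  quotv_scaleA quotv_scale1 quotv_scaleDr quotv_scaleDl.

Lemma quotv_pi_linear : linear quotv_pi_fun.
Proof. by move=> k u v; rewrite quotv_piD quotv_piZ. Qed.

Lemma quotv_disjoint : (W^C :&: W = 0)%VS.
Proof. by rewrite capvC capv_compl. Qed.

(* coordinates on the quotient come from the complement W^C of W *)
Definition quotv_r (q : quotv) : subvs_of (W^C)%VS :=
  vsproj (W^C)%VS (daddv_pi (W^C)%VS W (repr (q : Quotient.quot W))).

Lemma quotv_r_pi (v : vT) :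
  quotv_r (quotv_pi_fun v) = vsproj (W^C)%VS (daddv_pi (W^C)%VS W v).
Proof.
have: repr (quotv_pi_fun v : Quotient.quot W) - v \in W.
  by apply/quotv_pi_eq; rewrite quotv_pi_funK.
move=> inW; congr vsproj; apply/eqP; rewrite -subr_eq0 -linearB.
set w := _ - v in inW *.
have wWC : w \in (W + W^C)%VS by rewrite addv_complf memvf.
have := daddv_pi_add (capv_compl W) wWC.
rewrite (daddv_pi_id (capv_compl W) inW) => /eqP.
by rewrite -[X in _ == X]addr0 (inj_eq (addrI w)).
Qed.

Lemma quotv_r_bij : bijective quotv_r.
Proof.
exists (fun u => quotv_pi_fun (vsval u)) => [q | u].
  rewrite -[q]quotv_pi_funK; move: (repr _) => v; rewrite quotv_r_pi.
  rewrite vsprojK ?memv_pi //; apply/quotv_pi_eq.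
  have vWC : v \in (W^C + W)%VS by rewrite addvC addv_complf memvf.
  have {2}<- := daddv_pi_add quotv_disjoint vWC.
  by rewrite opprD addrA subrr sub0r memvN memv_pi.
by rewrite quotv_r_pi daddv_pi_id ?quotv_disjoint ?subvsP // vsvalK.
Qed.

Lemma quotv_r_linear : linear quotv_r.
Proof.
move=> k p q; rewrite -(quotv_pi_funK p) -(quotv_pi_funK q).
by rewrite -quotv_pi_linear !quotv_r_pi !linearP.
Qed.

Fact quotv_vect_iso : Vector.axiom (dim (subvs_of (W^C)%VS)) quotv.
Proof.
exists (fun q => v2r (quotv_r q)).
  by move=> k p q; rewrite quotv_r_linear linearP.
apply: bij_comp quotv_r_bij.
by exists (@r2v K (subvs_of (W^C)%VS)); [apply: v2rK | apply: r2vK].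
Qed.

HB.instance Definition _ := Lmodule_hasFinDim.Build K quotv quotv_vect_iso.

HB.instance Definition _ :=
  GRing.isLinear.Build K vT quotv _ quotv_pi_fun quotv_pi_linear.

Definition quotv_pi : 'Hom(vT, quotv) := linfun quotv_pi_fun.

Lemma lker_quotv_pi : lker quotv_pi = W.
Proof.
apply/vspaceP=> v; rewrite memv_ker lfunE /= -(linear0 quotv_pi_fun).
apply/eqP/idP => [/quotv_pi_eq|Wv]; first by rewrite subr0.
by apply/quotv_pi_eq; rewrite subr0.
Qed.

Lemma quotv_pi_surj (q : quotv) : exists v, quotv_pi v = q.
Proof.
by exists (repr (q : Quotient.quot W)); rewrite lfunE; apply: quotv_pi_funK.
Qed.

End QuotientSpace.

(* Meaningful only when f maps W into Z; see quotv_mapE. *)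
Definition quotv_map (K : fieldType) (vT wT : vectType K)
    (W : {vspace vT}) (Z : {vspace wT}) (f : 'Hom(vT, wT)) :
    'Hom(quotv W, quotv Z) :=
  linfun (fun q : quotv W => quotv_pi Z (f (repr (q : Quotient.quot W)))).

Lemma quotv_mapE (K : fieldType) (vT wT : vectType K)
    (W : {vspace vT}) (Z : {vspace wT}) (f : 'Hom(vT, wT)) (v : vT) :
  (f @: W <= Z)%VS -> quotv_map W Z f (quotv_pi W v) = quotv_pi Z (f v).
Proof.
move=> fWZ; pose g (q : quotv W) := quotv_pi Z (f (repr (q : Quotient.quot W))).
have g_pi u : g (quotv_pi W u) = quotv_pi Z (f u).
  apply/eqP; rewrite -subr_eq0 -!linearB -memv_ker lker_quotv_pi.
  rewrite (subvP fWZ) // memv_img //; apply/quotv_pi_eq.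
  by rewrite quotv_pi_funK lfunE.
have g_lin : linear g.
  move=> k p q.
  have [u <-] := quotv_pi_surj p; have [w <-] := quotv_pi_surj q.
  by rewrite -linearP !g_pi !linearP.
pose gM := GRing.isLinear.Build _ _ _ _ g g_lin.
pose gL : {linear quotv W -> quotv Z} := HB.pack g gM.
by rewrite -g_pi; apply: (lfunE gL).
Qed.

Section Representations.
Variables (K : fieldType) (Q : quiver).

(* A finite length module over the path algebra (finite-dimensional when the
   quiver is acyclic), given by its vertex spaces and arrow maps. *)
Record rep := Rep {
  space : vertex Q -> vectType K;
  rmap : forall a : arrow Q, 'Hom(space (src a), space (tgt a)) }.

Definition rep_family (M N : rep) := forall x, 'Hom(space M x, space N x).

Definition is_hom (M N : rep) (f : rep_family M N) : Prop :=
  forall (a : arrow Q) (v : space M (src a)),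
    f (tgt a) (rmap M a v) = rmap N a (f (src a) v).

Definition iso (M N : rep) : Prop :=
  exists f : rep_family M N, is_hom f /\ forall x, bijective (f x).

(* The boolean y == x is the dimension, 1 or 0, of the space at y. *)
Definition simple_at (x : vertex Q) : rep :=
  @Rep (fun y => 'rV[K]_(y == x)) (fun _ => 0).

Section Submodules.
Variable M : rep.

Definition supp (x : vertex Q) : Prop := (fullv : {vspace space M x}) != 0%VS.

(* A submodule of M = \bigoplus_x (space M x) is the sum of its components at
   the vertices. *)
Record subrep := SubRep {
  sspace :> forall x, {vspace space M x};
  sspaceP : forall a, (rmap M a @: sspace (src a) <= sspace (tgt a))%VS }.

Fact subrep0_subproof a : (rmap M a @: (0 : {vspace _}) <= 0)%VS.
Proof. by rewrite limg0. Qed.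
Definition subrep0 : subrep := @SubRep (fun x => 0%VS) subrep0_subproof.

Fact subrep1_subproof a : (rmap M a @: fullv <= fullv)%VS.
Proof. exact: subvf. Qed.
Definition subrep1 : subrep := @SubRep (fun x => fullv) subrep1_subproof.

Definition subrep_le (U V : subrep) : Prop := forall x, (U x <= V x)%VS.
Definition subrep_eq (U V : subrep) : Prop := forall x, U x = V x.
Definition subrep_lt (U V : subrep) : Prop :=
  subrep_le U V /\ ~ subrep_eq U V.

Definition complementary (U V : subrep) : Prop :=
  forall x, (U x + V x = fullv)%VS /\ (U x :&: V x = 0)%VS.

Definition nonzero : Prop := ~ subrep_eq subrep1 subrep0.

Definition indecomposable : Prop :=
  nonzero /\
  forall U V : subrep, complementary U V ->
    subrep_eq U subrep0 \/ subrep_eq V subrep0.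

Definition simple : Prop :=
  nonzero /\
  forall U : subrep, subrep_eq U subrep0 \/ subrep_eq U subrep1.

Definition rep_of_subrep (U : subrep) : rep :=
  @Rep (fun x => subvs_of (U x))
    (fun a => linfun (vsproj (U (tgt a))) \o rmap M a \o linfun vsval)%VF.

Lemma rep_of_subrepE (U : subrep) a (v : space (rep_of_subrep U) (src a)) :
  vsval (rmap (rep_of_subrep U) a v) = rmap M a (vsval v).
Proof.
rewrite /= !comp_lfunE !lfunE /= vsprojK // (subvP (sspaceP U a)) //.
by rewrite memv_img // subvsP.
Qed.

Definition quotrep (W : subrep) : rep :=
  @Rep (fun x => quotv (W x)) (fun a => quotv_map _ _ (rmap M a)).

Lemma quotrep_pi_hom (W : subrep) :
  @is_hom M (quotrep W) (fun x => quotv_pi (W x)).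
Proof. by move=> a v; rewrite /= quotv_mapE ?sspaceP. Qed.

End Submodules.

(* The submodule U :&: V of M, seen as a submodule of U. *)
Section SubIn.
Variables (M : rep) (U V : subrep M).

Definition subin_space x : {vspace space (rep_of_subrep U) x} :=
  (linfun vsval @^-1: V x)%VS.

Fact subin_subproof a :
  (rmap (rep_of_subrep U) a @: subin_space (src a) <= subin_space (tgt a))%VS.
Proof.
apply/subvP=> _ /memv_imgP[v vV ->].
rewrite -memv_preim lfunE.
suff: vsval (rmap (rep_of_subrep U) a v) \in V (tgt a) by [].
rewrite rep_of_subrepE.
apply: (subvP (sspaceP V a)); apply: memv_img.
by move: vV; rewrite -memv_preim lfunE.
Qed.

Definition subin : subrep (rep_of_subrep U) := @SubRep _ subin_space subin_subproof.

(* U / V, for V contained in U *)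
Definition subquot : rep := quotrep subin.

End SubIn.

Section Composition.
Variable M : rep.

Definition composition_series (n : nat) (c : nat -> subrep M) : Prop :=
  [/\ subrep_eq (c 0%N) (subrep0 M), subrep_eq (c n) (subrep1 M)
    & forall i, (i < n)%N ->
        subrep_le (c i) (c i.+1) /\ simple (subquot (c i.+1) (c i))].

Definition composition_factor (S : rep) : Prop :=
  exists n c, composition_series n c /\
    exists2 i, (i < n)%N & iso (subquot (c i.+1) (c i)) S.

(* By Jordan-Hoelder the choice of the composition series is immaterial. *)
Definition multiplicity_free : Prop :=
  exists n c, composition_series n c /\
    forall i j, (i < n)%N -> (j < n)%N ->
      iso (subquot (c i.+1) (c i)) (subquot (c j.+1) (c j)) -> i = j.

End Composition.

Record digraph (V : Type) := Digraph {
  is_node : V -> Prop;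
  edge : V -> V -> Prop }.

Definition digraph_eq (V : Type) (G H : digraph V) : Prop :=
  (forall x, is_node G x <-> is_node H x) /\
  (forall x y, edge G x y <-> edge H x y).

Definition induced (V : Type) (G : digraph V) (H : V -> Prop) : digraph V :=
  Digraph H (fun x y => [/\ H x, H y & edge G x y]).

Definition short_exact (A E B : rep) (i : rep_family A E) (p : rep_family E B)
    : Prop :=
  [/\ is_hom i, is_hom p & forall x,
    [/\ lker (i x) = 0%VS, limg (i x) = lker (p x) & limg (p x) = fullv]].

Definition splits (E B : rep) (p : rep_family E B) : Prop :=
  exists s : rep_family B E, is_hom s /\ forall x v, p x (s x v) = v.

(* Ext^1 (B, A) in Yoneda's sense: submodule A, quotient B. *)
Definition Ext1_nonzero (B A : rep) : Prop :=
  exists (E : rep) (i : rep_family A E) (p : rep_family E B),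
    short_exact i p /\ ~ splits p.

Definition Ext_R : digraph (vertex Q) :=
  Digraph (fun _ => True)
    (fun x y => Ext1_nonzero (simple_at x) (simple_at y)).

Definition Ext_Lambda (M : rep) : digraph (vertex Q) :=
  Digraph (fun x => composition_factor M (simple_at x))
    (fun x y => exists W V U : subrep M,
      [/\ subrep_lt W V /\ subrep_lt V U,
          forall V', subrep_lt W V' -> subrep_lt V' U -> subrep_eq V' V,
          iso (subquot U V) (simple_at x)
        & iso (subquot V W) (simple_at y)]).

End Representations.

(* Main.v *)
(** On an acyclic quiver [Ext^1] between two vertices is nonzero exactly when an
    arrow [a : x -> y] joins them.  If [M] is indecomposable and contains both
    vertices, then [a] acts nontrivially on [M]: deleting [a] disconnects the
    quiver, so otherwise [M] would split along the two sides.  Hence the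
    vertices reachable from [x] span a submodule [U], and dropping [x], then
    also [y], gives [V] and [W] with [U / W] uniserial.  Conversely, if no arrow
    goes from [x] to [y], then adding [U] at [x] to [W] gives a second submodule
    between [W] and [U]. *)

Require Import Defs.
From HB Require Import structures.
From mathcomp Require Import all_boot all_order all_algebra.
(* Again, since [vector] also exports a [space]. *)
Import Defs.

Set Implicit Arguments.
Unset Strict Implicit.
Unset Printing Implicit Defensive.

Import GRing.Theory VectorInternalTheory.
Local Open Scope ring_scope.

(** * Directed and undirected paths in an acyclic quiver *)

Section Graph.
Variable Q : quiver.

Definition step : rel (vertex Q) :=
  fun x y => [exists a, (src a == x) && (tgt a == y)].

(** Adjacency in the underlying graph with the edge [a] deleted. *)
Definition step_avoiding (a : arrow Q) : rel (vertex Q) :=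
  fun x y => [exists b, (b != a) && joins b x y].

Lemma step_arrow (a : arrow Q) : step (src a) (tgt a).
Proof. by apply/existsP; exists a; rewrite !eqxx. Qed.

Lemma step_avoiding_arrow (a b : arrow Q) :
  b != a -> step_avoiding a (src b) (tgt b).
Proof. by move=> ba; apply/existsP; exists b; rewrite ba /joins !eqxx. Qed.

Lemma step_avoiding_sym a : symmetric (step_avoiding a).
Proof.
by move=> x y; apply: eq_existsb => b; rewrite /joins orbC.
Qed.

(* The edge a closes the path y :: p into a cycle of the underlying graph. *)
Lemma path_avoiding_cycle (a : arrow Q) y p :
    path (step_avoiding a) y p -> uniq (y :: p) ->
  exists b c, [/\ map fst ((y, b) :: c) = y :: p,
    path (fun q r => joins q.2 q.1 r.1) (y, b) c,
    last (y, b) c = (last y p, a),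
    uniq (map snd ((y, b) :: c))
    & all (fun q => (q.2 == a) ||
             ((src q.2 \in y :: p) && (tgt q.2 \in y :: p))) ((y, b) :: c)].
Proof.
elim: p y => [|z p IHp] y /=.
  by move=> _ _; exists a, [::]; rewrite /= eqxx.
case/andP=> /existsP[b /andP[ba byz]] zp /andP[yzp up].
have [b' [c [fc rc lc uc ac]]] := IHp z zp up.
exists b, ((z, b') :: c); split=> //.
- by congr (_ :: _).
- by apply/andP.
(* The edge [b] is new: it differs from [a], and every other edge used so far has both ends in
   [z :: p], where [y] does not occur. *)
- apply/andP; split; [apply/mapP => -[q /(allP ac) /orP[|]] | exact: uc].
    by move=> /eqP-> /= eb; rewrite eb eqxx in ba.
  move=> /andP[qs qt] /= eb; move: byz qs qt; rewrite -eb /joins.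
  by case/orP=> /andP[/eqP-> /eqP->] => [qs _ | _ qs]; rewrite qs in yzp.
apply/andP; split.
  by case/orP: byz => /andP[/eqP-> /eqP->] /=; rewrite !inE !eqxx !orbT.
apply: sub_all ac => q /= /orP[-> // | /andP[qs qt]].
by rewrite !(in_cons y) qs qt !orbT.
Qed.

Lemma connect_sym_avoiding a : connect_sym (step_avoiding a).
Proof. exact: sym_connect_sym (step_avoiding_sym a). Qed.

Hypothesis hQ : acyclic Q.

(** Every edge of a forest is a bridge: a detour around [a], shortened to a path without repeated
    vertices, would close up with [a] to a cycle. *)
Lemma acyclic_bridge (a : arrow Q) :
  ~~ connect (step_avoiding a) (tgt a) (src a).
Proof.
apply/negP=> /connectP[p0 /shortenP[p yp uyp _] lx].
have [b [c [fc rc lc uc _]]] := path_avoiding_cycle yp uyp.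
have /negP := hQ ((tgt a, b) :: c); apply.
rewrite /graph_cycle fc uyp uc /= rcons_path rc lc /=.
by rewrite -lx /joins !eqxx.
Qed.

(** A directed way back, cut at its first passage through [a], already reaches [src a] without using
    [a], against [acyclic_bridge]. *)
Lemma acyclic_directed (a : arrow Q) : ~~ connect step (tgt a) (src a).
Proof.
apply/negP=> /connectP[p yp lx]; have /negP := acyclic_bridge a; apply.
rewrite lx; elim: p (tgt a) yp lx => [|z p IHp] y /=; first by rewrite connect0.
case/andP=> /existsP[b /andP[/eqP<- /eqP<-]] zp lx.
have [ab|ba] := eqVneq b a; first by rewrite -lx ab connect0.
exact: connect_trans (connect1 (step_avoiding_arrow ba)) (IHp _ zp lx).
Qed.

Lemma acyclic_no_loop (a : arrow Q) : src a != tgt a.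
Proof.
by apply: contraNneq (acyclic_directed a) => ->; rewrite connect0.
Qed.

(** Otherwise the path followed by [b] would lead around the bridge [a], or, if it runs through [a],
    its tail would lead from [tgt b] back to [src b]. *)
Lemma acyclic_no_bypass (a b : arrow Q) :
  connect step (src a) (src b) -> tgt b = tgt a -> src b = src a.
Proof.
move=> /connectP[p xp lx] tba; apply/eqP/negPn/negP=> sba.
have ba : b != a by apply: contraNneq sba => ->.
suff: connect (step_avoiding a) (src a) (src b) \/ connect step (tgt a) (src b).
  case=> [sab|]; last by rewrite -tba; apply/negP/acyclic_directed.
  have /negP := acyclic_bridge a; apply.
  rewrite (connect_sym_avoiding a) -tba.
  exact: connect_trans sab (connect1 (step_avoiding_arrow ba)).
rewrite lx; elim: p (src a) xp {lx} => [|z p IHp] y /=.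
  by left; rewrite connect0.
case/andP=> /existsP[c /andP[/eqP<- /eqP<-]] zp.
have [<- | ca] := eqVneq c a; first by right; apply/connectP; exists p.
case: (IHp _ zp) => [cz|]; last by right.
by left; apply: connect_trans (connect1 (step_avoiding_arrow ca)) cz.
Qed.

End Graph.

(** * Linear maps and dimension counts *)

Section Linear.
Variable K : fieldType.
Implicit Types vT wT : vectType K.

Lemma dim0_eq0 vT (v : vT) : \dim {:vT} = 0%N -> v = 0.
Proof.
by move/eqP; rewrite dimv_eq0 => /eqP vT0; apply/eqP; rewrite -memv0 -vT0 memvf.
Qed.

Lemma linfunE vT wT (f : vT -> wT) : linear f -> linfun f =1 f.
Proof.
move=> fL; pose fM := GRing.isLinear.Build _ _ _ _ f fL.
exact: lfunE (HB.pack f fM : {linear vT -> wT}).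
Qed.

Lemma bij_dim vT wT (f : 'Hom(vT, wT)) :
  bijective f -> \dim {:vT} = \dim {:wT}.
Proof.
case=> g fK gK; have kf : lker f == 0%VS by apply/lker0P; apply: can_inj fK.
rewrite -(limg_dim_eq (eqP _ : fullv :&: lker f = 0)%VS); last first.
  by rewrite capfv.
congr (\dim _); apply/eqP; rewrite eqEsubv subvf; apply/subvP=> w _.
by rewrite -(gK w) memv_img ?memvf.
Qed.

(** The partial identity in coordinates: an explicit isomorphism whenever the dimensions agree. *)
Definition pid_map vT wT : 'Hom(vT, wT) :=
  Hom (pid_mx (dim vT)).

Lemma pid_map_bij vT wT :
  \dim {:vT} = \dim {:wT} -> bijective (pid_map vT wT).
Proof.
rewrite !dimvf => e; exists (pid_map wT vT) => v; rewrite unlock /= r2vK.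
  by rewrite -mulmxA mul_pid_mx -e !minnn pid_mx_1 mulmx1 v2rK.
by rewrite -mulmxA mul_pid_mx e !minnn pid_mx_1 mulmx1 v2rK.
Qed.

Lemma dim_quotv vT (W : {vspace vT}) :
  \dim {:quotv W} = (\dim {:vT} - \dim W)%N.
Proof.
rewrite -(limg_ker_dim (quotv_pi W) fullv) capfv lker_quotv_pi addKn.
congr (\dim _); apply/esym/eqP; rewrite eqEsubv subvf; apply/subvP=> q _.
by have [v <-] := quotv_pi_surj q; rewrite memv_img ?memvf.
Qed.
End Linear.

(** * Representations and their dimension vectors *)

Section Representation.
Variables (K : fieldType) (Q : quiver).
Implicit Types (M S T : rep K Q) (x y z : vertex Q).

Lemma subrep_lt_dim M (U V : subrep M) :
  subrep_lt U V -> exists z, (\dim (U z) < \dim (V z))%N.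
Proof.
case=> leUV neUV.
have [/existsP[z dz] | /existsPn dUV] := boolP [exists z, (\dim (U z) < \dim (V z))%N].
  by exists z.
case: neUV => z; apply/eqP; rewrite eqEdim leUV /=.
by rewrite leqNgt; apply: dUV.
Qed.

Lemma dim_subquot M (U V : subrep M) z : subrep_le V U ->
  \dim {:space (subquot U V) z} = (\dim (U z) - \dim (V z))%N.
Proof.
move=> leVU; rewrite dim_quotv dimvf; congr (_ - _)%N.
(* The inclusion [i] is injective with image [U z], so pulling [V z] back along it keeps the
   dimension. *)
set i : 'Hom(subvs_of (U z), space M z) := linfun vsval.
have ki : (lker i = 0)%VS.
  by apply/eqP/lker0P => u v; rewrite !lfunE; apply: val_inj.
rewrite -(@limg_dim_eq _ _ _ i) ?ki ?capv0 // lpreimK //.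
apply/subvP=> v /(subvP (leVU z)) Uv; rewrite -(vsprojK Uv).
by rewrite -(lfunE vsval) memv_img ?memvf.
Qed.

Lemma iso_dim S T z : iso S T -> \dim {:space S z} = \dim {:space T z}.
Proof. by case=> f [_ fb]; apply: bij_dim (fb z). Qed.

(** The dimension vector of the simple module at [x]. Without loops it fixes [S] up to isomorphism,
    so isomorphism with [simple_at] reduces to counting dimensions. *)
Definition concentrated S x :=
  forall z, \dim {:space S z} = (z == x).

Lemma simple_at_concentrated x : concentrated (simple_at K x) x.
Proof. by move=> z; rewrite dimvf dim_matrix mul1r. Qed.

Lemma subrep_step M (U V : subrep M) x : subrep_le V U ->
  concentrated (subquot U V) x -> forall z, \dim (U z) = (\dim (V z) + (z == x))%N.
Proof.
move=> leVU h z; rewrite -(h z) dim_subquot // subnKC //.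
exact: dimvS.
Qed.

Lemma iso_simple_step M (U V : subrep M) x : subrep_le V U ->
  iso (subquot U V) (simple_at K x) ->
  forall z, \dim (U z) = (\dim (V z) + (z == x))%N.
Proof.
move=> leVU h; apply: subrep_step => // z.
by rewrite (iso_dim z h); apply: simple_at_concentrated.
Qed.

Hypothesis hQ : acyclic Q.

(** There are no loops, so one end of each arrow carries the zero space. *)
Lemma concentrated_arrow S x (a : arrow Q) (v : space S (src a)) :
  concentrated S x -> rmap S a v = 0.
Proof.
move=> Sx; have [sx | sx] := eqVneq (src a) x; last first.
  by rewrite (@dim0_eq0 _ _ v) ?linear0 // Sx (negPf sx).
apply: dim0_eq0; rewrite Sx -sx eq_sym.
by rewrite (negPf (acyclic_no_loop hQ a)).
Qed.

(** All arrows act as zero on both sides, so any family of bijections at the vertices commutes with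
    them. *)
Lemma concentrated_iso S T x :
  concentrated S x -> concentrated T x -> iso S T.
Proof.
move=> Sx Tx; exists (fun z => pid_map (space S z) (space T z)); split.
  by move=> a v; rewrite (concentrated_arrow _ Sx) (concentrated_arrow _ Tx) linear0.
by move=> z; apply: pid_map_bij; rewrite Sx Tx.
Qed.

(** A line in the space at a sink of the support is a nonzero submodule, hence everything. *)
Lemma simple_concentrated S : simple S -> exists x, concentrated S x.
Proof.
case=> nz0 sub01; pose P z := (fullv : {vspace space S z}) != 0%VS.
have [x0 Px0] : exists x, P x.
  have [/existsP[z dz] | /existsPn P0] := boolP [exists z, P z]; first by exists z.
  by case: nz0 => z; apply/eqP/negPn/P0.
pose r z := #|connect (@step Q) z|.
(* Minimising the number of reachable vertices yields a sink: the target of an arrow out of [x]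
   reaches fewer vertices, as it cannot reach [x] again. *)
have [x Px minx] := arg_minnP r Px0.
have sink (a : arrow Q) : src a = x -> ~~ P (tgt a).
  move=> sa; apply/negP=> /minx; rewrite leqNgt => /negP; apply.
  apply: proper_card; apply/properP; split.
    apply/subsetP=> z; rewrite !unfold_in; apply: connect_trans.
    by rewrite -sa connect1 ?step_arrow.
  exists x; first exact: connect0.
  by rewrite -sa; apply: acyclic_directed hQ a.
pose U z : {vspace space S z} := if z == x then <[vpick fullv]>%VS else 0%VS.
have UP a : (rmap S a @: U (src a) <= U (tgt a))%VS.
  rewrite /U; case: eqP => [/sink /negPn /eqP t0 | _]; last by rewrite limg0 sub0v.
  by apply: (subv_trans (subvf _)); rewrite t0 sub0v.
have Ux : U x != 0%VS by rewrite /U eqxx -dimv_eq0 dim_vline vpick0 -/(P x) Px.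
exists x => z; case: (sub01 (SubRep UP)) => [/(_ x) /= U0 | /(_ z) /= <-].
  by rewrite U0 eqxx in Ux.
rewrite /U; have [->|_] := eqVneq; last by rewrite dimv0.
by rewrite dim_vline vpick0 -/(P x) Px.
Qed.

(** * Composition series and multiplicities *)

Section CompositionSeries.
Variables (M : rep K Q) (n : nat) (c : nat -> subrep M).
Hypothesis hc : composition_series n c.

Definition factor i := subquot (c i.+1) (c i).

Lemma factor_concentrated i : (i < n)%N -> exists x, concentrated (factor i) x.
Proof. by case: hc => _ _ h /h[_]; apply: simple_concentrated. Qed.

Lemma factor_concentrated_at i x : (i < n)%N ->
  \dim {:space (factor i) x} != 0%N -> concentrated (factor i) x.
Proof.
move=> /factor_concentrated[z iz]; rewrite iz.
by case: (eqVneq x z) => [-> |].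
Qed.

Lemma dim_sum_factors x :
  \dim {:space M x} = (\sum_(i < n) \dim {:space (factor i) x})%N.
Proof.
case: hc => c0 c1 h; have <- : (c n x = fullv :> {vspace _}) by rewrite c1.
suff: forall m, (m <= n)%N ->
    \dim (c m x) = (\sum_(i < m) \dim {:space (factor i) x})%N by apply.
elim=> [_ | m IHm mn]; first by rewrite big_ord0 c0 dimv0.
have [le _] := h m mn; rewrite big_ord_recr /= -IHm 1?ltnW //.
by rewrite dim_subquot // subnKC // dimvS.
Qed.

Lemma supp_factor x : supp M x -> composition_factor M (simple_at K x).
Proof.
rewrite /supp -dimv_eq0 dim_sum_factors => Mx.
have [/existsP[i ix] | /existsPn h] :=
  boolP [exists i : 'I_n, \dim {:space (factor i) x} != 0%N].
  exists n, c; split=> //; exists i => //.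
  exact: concentrated_iso (factor_concentrated_at _ ix) (simple_at_concentrated x).
by rewrite big1 // in Mx => i _; apply/eqP/negPn.
Qed.

End CompositionSeries.

(** Two factors that are nonzero at [x] are both concentrated there, hence isomorphic, hence the
    same factor; so at most one factor contributes to the dimension at [x]. *)
Lemma multiplicity_free_dim M x :
  multiplicity_free M -> (\dim {:space M x} <= 1)%N.
Proof.
case=> n [c [hc inj]]; rewrite (dim_sum_factors hc).
have [/existsP[i ix] | /existsPn h] :=
  boolP [exists i : 'I_n, \dim {:space (factor c i) x} != 0%N]; last first.
  by rewrite big1 // => i _; apply/eqP/negPn.
have iC := factor_concentrated_at hc (ltn_ord i) ix.
rewrite (bigD1 i) //= big1 ?addn0 ?iC ?leq_b1 // => j ji.
apply: contraNeq ji => jx; apply/eqP/val_inj/inj; rewrite ?ltn_ord //.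
exact: concentrated_iso (factor_concentrated_at hc (ltn_ord j) jx) iC.
Qed.

Lemma composition_factor_supp M x :
  composition_factor M (simple_at K x) -> supp M x.
Proof.
case=> n [c [[_ _ h] [i /h[le _] /iso_simple_step -/(_ le x)]]].
rewrite eqxx addn1 /supp -dimv_eq0 -lt0n => e.
by apply: leq_trans (dimvS (subvf (c i.+1 x))); rewrite e.
Qed.

(** * Extensions between simple modules *)

Lemma Ext1_arrow x y : Ext1_nonzero (simple_at K x) (simple_at K y) ->
  exists a : arrow Q, src a = x /\ tgt a = y.
Proof.
case=> E [i [p [[_ hp ex] nsp]]].
have [/existsP[a /andP[/eqP ax /eqP ay]] | /existsPn noa] :=
  boolP [exists a : arrow Q, (src a == x) && (tgt a == y)]; first by exists a.
(* Sections chosen at each vertex separately form a homomorphism, since the arrows of [E] kill their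
   values: out of [x] the result lies in the image of [i], which is zero at every vertex but [y]. *)
case: nsp; exists (fun z => (p z)^-1%VF); split; last first.
  by move=> z v; have [_ _ pz] := ex z; rewrite limg_lfunVK // pz memvf.
move=> a v; rewrite (_ : rmap (simple_at K x) a v = 0) ?zero_lfunE // linear0.
have [ax | ax] := eqVneq (src a) x; last first.
  rewrite (@dim0_eq0 _ _ v) ?linear0 //.
  by rewrite simple_at_concentrated (negPf ax).
have [_ ip _] := ex (tgt a).
have: rmap E a ((p (src a))^-1%VF v) \in lker (p (tgt a)).
  by rewrite memv_ker hp /= zero_lfunE.
rewrite -ip => /memv_imgP[u _ ->]; rewrite (@dim0_eq0 _ _ u) ?linear0 //.
rewrite simple_at_concentrated; have := noa a.
by rewrite ax eqxx /= => /negPf ->.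
Qed.

(** The sum of the two simples with [a] acting as the 1 by 1 identity from top to bottom. [const_mx]
    adapts to the Boolean dimensions at the ends of [b]. *)
Definition arrow_extension (a : arrow Q) : rep K Q :=
  @Rep K Q (fun z => (space (simple_at K (tgt a)) z *
                      space (simple_at K (src a)) z)%type)
    (fun b => linfun (fun v => (v.2 *m const_mx (b == a)%:R, 0))).

Lemma arrow_Ext1 (a : arrow Q) :
  Ext1_nonzero (simple_at K (src a)) (simple_at K (tgt a)).
Proof.
set S := simple_at K (src a); set T := simple_at K (tgt a).
pose i z : 'Hom(space T z, space (arrow_extension a) z) :=
  linfun (fun v => (v, 0)).
pose p z : 'Hom(space (arrow_extension a) z, space S z) := linfun snd.
have iE z v : i z v = (v, 0).
  apply: linfunE => k u w; congr (_, _).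
  by rewrite -[RHS]/(k *: 0 + 0) scaler0 addr0.
have pE z v : p z v = v.2 by apply: linfunE.
have mE b v : rmap (arrow_extension a) b v = (v.2 *m const_mx (b == a)%:R, 0).
  apply: linfunE => k u w; congr (_, _); last first.
    by rewrite -[RHS]/(k *: 0 + 0) scaler0 addr0.
  by rewrite -[LHS]/((k *: u.2 + w.2) *m _) mulmxDl -scalemxAl.
exists (arrow_extension a), i, p; split.
  split=> [b v | b v | z].
  - by rewrite mE !iE mul0mx zero_lfunE.
  - by rewrite mE !pE /= zero_lfunE.
  split.
  - by apply/eqP/lker0P => u v; rewrite !iE => -[].
  - apply/vspaceP=> -[u v]; rewrite memv_ker pE /=.
    apply/memv_imgP/eqP => [[w _]|->]; first by rewrite iE => -[].
    by exists u; rewrite ?memvf ?iE.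
  apply/eqP; rewrite eqEsubv subvf; apply/subvP=> v _.
  by rewrite (_ : v = p z (0, v)) ?memv_img ?memvf // pE.
case=> s [sh /= ps].
pose v : space S (src a) := const_mx 1.
(* A section must commute with [a] at the generator [v]. The first components are zero on one side
   and one on the other. *)
have := congr1 fst (sh a v); rewrite zero_lfunE linear0 mE -pE ps /=.
have i0 : 'I_(tgt a == tgt a) by rewrite eqxx; exact: ord0.
move/matrixP/(_ 0 i0)/eqP; rewrite !mxE eq_sym.
rewrite (eq_bigr (fun=> 1)); last by move=> j _; rewrite !mxE eqxx mulr1.
by rewrite sumr_const card_ord eqxx oner_eq0.
Qed.

(** * Arrows inside the support of an indecomposable module *)

Lemma full_on_closed M (P : pred (vertex Q)) :
    (forall b : arrow Q, P (src b) -> P (tgt b) || (rmap M b == 0)) ->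
  forall b : arrow Q, (rmap M b @: (if P (src b) then fullv else 0) <=
                       (if P (tgt b) then fullv else 0))%VS.
Proof.
move=> h b; have := h b; case: (P (src b)) => [/(_ isT)|_].
  by case: (P (tgt b)) => /= [_|/eqP ->]; rewrite ?subvf ?lim0g.
by rewrite limg0 sub0v.
Qed.

(** The two sides of a deleted arrow and the terms of the chain [W], [V], [U] are all submodules of
    this shape. *)
Definition full_on M P h : subrep M :=
  @SubRep K Q M (fun z => if P z then fullv else 0%VS) (@full_on_closed M P h).

Lemma arrow_nonzero M (a : arrow Q) : indecomposable M ->
  supp M (src a) -> supp M (tgt a) -> rmap M a != 0.
Proof.
case=> _ dec sx sy; apply/negP=> /eqP a0.
(* The component of [src a] once [a] is deleted. Only [a] can join it to its complement, and [a]
   acts as zero, so both parts carry submodules. *)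
pose C z := connect (step_avoiding a) (src a) z.
have CE b : b != a -> C (src b) = C (tgt b).
  move=> ba; apply/idP/idP => h; apply: connect_trans h (connect1 _).
    exact: step_avoiding_arrow.
  by rewrite step_avoiding_sym step_avoiding_arrow.
have UP b : C (src b) -> C (tgt b) || (rmap M b == 0).
  have [-> _ | ba] := eqVneq b a; first by rewrite a0 eqxx orbT.
  by rewrite CE // => ->.
have VP b : ~~ C (src b) -> ~~ C (tgt b) || (rmap M b == 0).
  have [-> _ | ba] := eqVneq b a; first by rewrite a0 eqxx orbT.
  by rewrite CE // => ->.
(* Neither summand is zero: one contains the space at [src a], the other, as [a] is a bridge, the
   space at [tgt a]. *)
case: (dec (full_on UP) (@full_on M (predC C) VP)) => [z | /(_ (src a)) | /(_ (tgt a))].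
- by rewrite /=; case: (C z); rewrite ?addv0 ?add0v ?capv0 ?cap0v.
- by rewrite /= /C connect0 => h; rewrite /supp h eqxx in sx.
rewrite /= /C connect_sym_avoiding (negPf (acyclic_bridge hQ a)) /= => h.
by rewrite /supp h eqxx in sy.
Qed.

End Representation.

(** * Comparison of the two graphs on the support *)

Theorem theorem3p2 (K : fieldType) (Q : quiver) (hQ : acyclic Q)
    (M : rep K Q) (hind : indecomposable M) (hmf : multiplicity_free M) :
  digraph_eq (Ext_Lambda M) (induced (Ext_R K Q) (supp M)).
Proof.
have dM z := multiplicity_free_dim hQ z hmf.
split=> [x | x y] /=.
  split; first exact: composition_factor_supp.
  by case: hmf => n [c [hc _]]; exact: (supp_factor hQ hc).
split=> [[W [V [U [[WV VU] uniqV isoUV isoVW]]]] | [sx sy]].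
  have dU := iso_simple_step VU.1 isoUV; have dV := iso_simple_step WV.1 isoVW.
  have suppM (U' : subrep M) z : (0 < \dim (U' z))%N -> supp M z.
    move=> U'z; rewrite /supp -dimv_eq0 -lt0n.
    exact: leq_trans U'z (dimvS (subvf _)).
  have sx : supp M x by apply: (suppM U); rewrite dU eqxx addn1.
  have sy : supp M y by apply: (suppM V); rewrite dV eqxx addn1.
  (* If [x] and [y] agreed, [U x] would have dimension at least two. *)
  have xy : x != y.
    apply: contraTneq (dM x) => exy; rewrite -ltnNge.
    apply: leq_trans (dimvS (subvf (U x))).
    by rewrite dU dV -exy eqxx !addn1.
  split=> //.
  have [/existsP[a /andP[/eqP <- /eqP <-]] | /existsPn noa] :=
    boolP [exists a : arrow Q, (src a == x) && (tgt a == y)].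
    exact: arrow_Ext1.
  have WU : subrep_le W U.
    by move=> z; apply: subv_trans (WV.1 z) (VU.1 z).
  have eqWU z : z != x -> z != y -> W z = U z.
    move=> zx zy; apply/eqP; rewrite eqEdim WU dU dV.
    by rewrite (negPf zx) (negPf zy) !addn0 /=.
  pose V' z := if z == x then U z else W z.
  (* Only arrows out of [x] need care. They land in [U], and by [noa] not at [y], the one vertex
     besides [x] where [U] and [W] differ. *)
  have V'P a : (rmap M a @: V' (src a) <= V' (tgt a))%VS.
    rewrite /V'; have [ax | ax] := eqVneq (src a) x; last first.
      apply: subv_trans (sspaceP W a) _.
      by case: ifP => // _; apply: WU.
    apply: subv_trans (sspaceP U a) _.
    have [// | tx] := eqVneq (tgt a) x; rewrite eqWU //.
    by have := noa a; rewrite ax eqxx.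
  have V'V : subrep_eq (SubRep V'P) V.
    apply: uniqV; split.
    - by move=> z; rewrite /= /V'; case: eqP => // _; apply: WU.
    - move/(_ x) => /(congr1 (fun u => \dim u)); rewrite /= /V' eqxx dU dV eqxx.
      by rewrite (negPf xy) addn0 addn1 => /n_Sn.
    - by move=> z; rewrite /= /V'; case: eqP => // _; apply: WU.
    move/(_ y) => /(congr1 (fun u => \dim u)); rewrite /= /V' eq_sym (negPf xy).
    by rewrite dU dV eqxx addn1 eq_sym (negPf xy) addn0 => /n_Sn.
  (* At [x] the dimension of [V'] is that of [U], one more than that of [V]. *)
  have := congr1 (fun u => \dim u) (V'V x); rewrite /= /V' eqxx dU eqxx addn1.
  by move/esym/n_Sn.
move=> /Ext1_arrow[a [ax ay]]; subst x y.
have Ma := arrow_nonzero hQ hind sx sy.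
pose r z := connect (@step Q) (src a) z.
have rS b : r (src b) -> r (tgt b).
  by move=> h; apply: connect_trans h (connect1 (step_arrow b)).
have rx b : r (src b) -> tgt b != src a.
  move=> h; apply: contraTneq h => e; rewrite /r -e; exact: acyclic_directed.
have hU b : r (src b) -> r (tgt b) || (rmap M b == 0) by move/rS ->.
pose v z := r z && (z != src a).
have hV b : v (src b) -> v (tgt b) || (rmap M b == 0).
  by case/andP=> h _; rewrite /v rS ?rx.
pose w z := v z && (z != tgt a).
(* An arrow from [w] into [tgt a] would start at [src a] by [acyclic_no_bypass], but [v] excludes
   that vertex. *)
have hW b : w (src b) -> w (tgt b) || (rmap M b == 0).
  case/andP=> /andP[h sb] _; rewrite /w /v rS // rx //=; apply/orP; left.
  move: sb.
  by apply: contraNneq => /(acyclic_no_bypass hQ h) ->.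
pose U : subrep M := full_on hU; pose V : subrep M := full_on hV.
pose W : subrep M := full_on hW.
have d1 z : supp M z -> \dim {:space M z} = 1%N.
  rewrite /supp -dimv_eq0 => h; apply/eqP.
  by rewrite eqn_leq dM lt0n h.
have ra : r (src a) by apply: connect0.
have va : v (tgt a).
  by rewrite /v rS // eq_sym acyclic_no_loop.
have VU : subrep_le V U.
  move=> z /=; rewrite /v; case: (r z) => //=; first exact: subvf.
have WV : subrep_le W V.
  move=> z /=; rewrite /w; case: (v z) => //=; first exact: subvf.
have dUV z : \dim (U z) = (\dim (V z) + (z == src a))%N.
  rewrite /= /v; have [-> | zx] := eqVneq z (src a); last by rewrite andbT addn0.
  by rewrite ra dimv0 d1.
have dVW z : \dim (V z) = (\dim (W z) + (z == tgt a))%N.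
  rewrite /= /w; have [-> | zx] := eqVneq z (tgt a); last by rewrite andbT addn0.
  by rewrite va dimv0 d1.
have isoU : iso (subquot U V) (simple_at K (src a)).
  apply: concentrated_iso (simple_at_concentrated _ _) => // z.
  by rewrite dim_subquot // dUV addKn.
have isoV : iso (subquot V W) (simple_at K (tgt a)).
  apply: concentrated_iso (simple_at_concentrated _ _) => // z.
  by rewrite dim_subquot // dVW addKn.
exists W, V, U; split=> //.
- split; split=> // e.
    by have := dVW (tgt a); rewrite (e (tgt a)) eqxx addn1 => /n_Sn.
  by have := dUV (src a); rewrite (e (src a)) eqxx addn1 => /n_Sn.
move=> V' WV' V'U.
have full z : supp M z -> (V' z != 0)%VS -> V' z = fullv.
  move=> /d1 Mz; rewrite -dimv_eq0 -lt0n => V'z.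
  by apply/eqP; rewrite eqEdim subvf Mz.
(* If [V'] is nonzero at [src a], it is full there, and the nonzero map of [a] makes it full at
   [tgt a] too; then no vertex is left where [U] exceeds it. *)
have V'x : V' (src a) = 0%VS.
  apply/eqP/negPn/negP=> /(full _ sx) V'x.
  have /(full _ sy) V'y : (V' (tgt a) != 0)%VS.
    apply: contraNneq Ma => V'y; apply/eqP/lfunP=> u.
    rewrite zero_lfunE; apply/eqP; rewrite -memv0 -V'y.
    by apply: (subvP (sspaceP V' a)); rewrite memv_img // V'x memvf.
  have [z] := subrep_lt_dim V'U; rewrite ltnNge => /negP; apply.
  have [-> | zx] := eqVneq z (src a); first by rewrite V'x dimvS ?subvf.
  have [-> | zy] := eqVneq z (tgt a); first by rewrite V'y dimvS ?subvf.
  rewrite dUV dVW (negPf zx) (negPf zy) !addn0 dimvS //.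
  exact: WV'.1.
have V'V : subrep_le V' V.
  move=> z; have [-> | zx] := eqVneq z (src a); first by rewrite V'x sub0v.
  by have := V'U.1 z; rewrite /= /v zx andbT.
(* Since [V'] lies in [V], it can exceed [W] only at [tgt a], and there it reaches the dimension of
   [V]. *)
have [z0] := subrep_lt_dim WV' => lt0.
have z0y : z0 = tgt a.
  apply/eqP/negPn/negP=> z0y; move: lt0; rewrite ltnNge => /negP; apply.
  by rewrite (leq_trans (dimvS (V'V z0))) // dVW (negPf z0y) addn0.
move=> z; apply/eqP; rewrite eqEdim V'V dVW.
have [-> | zy] := eqVneq z (tgt a); first by rewrite addn1 -z0y.
by rewrite addn0 dimvS //; apply: WV'.1.
Qed.
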